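(* Every counter system $\mathcal{C}=(C,Q,\mathcal{T})$ induced by one of the following types of steps is fully $\preceq_0$-compatible: lossy broadcast steps, disjunctive guard steps, synchronization steps, or asynchronous shared memory (ASM) steps.
   Context: For $\mathbf{v}\in\mathbb{N}^Q$ let $|\mathbf{v}|=\sum_{q\in Q}\mathbf{v}(q)$; for $q\in Q$ let $\mathbf{q}\in\mathbb{N}^Q$ be the multiset with one occurrence of $q$. A counter system (CS) is a triple $\mathcal{C}=(C,Q,\mathcal{T})$ with $C$ a finite set (controller states), $Q$ a finite set (user states), and a size-preserving step relation $\mathcal{T}\subseteq(C\times\mathbb{N}^Q)\times(C\times\mathbb{N}^Q)$ ($|\mathbf{v}|=|\mathbf{v}'|$ whenever $((c,\mathbf{v}),(c',\mathbf{v}'))\in\mathcal{T}$). Write $(c,\mathbf{v})\to(c',\mathbf{v}')$ for $((c,\mathbf{v}),(c',\mathbf{v}'))\in\mathcal{T}$. A configuration $(c,\mathbf{v})$ represents one controller process in state $c$ and $\mathbf{v}(q)$ user processes in each state $q$. Order: $(c,\mathbf{v})\preceq_0(d,\mathbf{w})$ iff $c=d$ and, for all $q\in Q$, $\mathbf{v}(q)\le\mathbf{w}(q)$ and $(\mathbf{v}(q)=0\Leftrightarrow\mathbf{w}(q)=0)$. $\mathcal{C}$ is forward $\preceq_0$-compatible if whenever $(c,\mathbf{v})\to(c',\mathbf{v}')$ and $(c,\mathbf{v})\preceq_0(d,\mathbf{w})$, there is a step $(d,\mathbf{w})\to(d',\mathbf{w}')$ with $(c',\mathbf{v}')\preceq_0(d',\mathbf{w}')$.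 It is backward $\preceq_0$-compatible if whenever $(c,\mathbf{v})\to(c',\mathbf{v}')$ and $(c',\mathbf{v}')\preceq_0(d',\mathbf{w}')$, there is a step $(d,\mathbf{w})\to(d',\mathbf{w}')$ with $(c,\mathbf{v})\preceq_0(d,\mathbf{w})$. Fully $\preceq_0$-compatible means both. Steps are made of local transitions taken simultaneously by distinct processes, each process taking at most one transition. A user process taking a transition from $p$ to $q$ ($p,q\in Q$) must be in $p$ and moves to $q$ (contributing $-\mathbf{p}+\mathbf{q}$ to $\mathbf{v}$); the controller taking a transition from $p$ to $q$ ($p,q\in C$) must be in state $p$ and moves to $q$. All processes taking no transition stay where they are. A CS is induced by steps of a given type if, for some finite set of local transitions of that type, $\mathcal{T}$ is the set of all steps of that type which they define: - Lossy broadcast. Transitions $p\xrightarrow{l}q$ with $p,q\in C$ or $p,q\in Q$ and $l\in\{!a,?a\mid a\in\Sigma\}$, $\Sigma$ a finite alphabet. A step consists of one or more processes taking the same broadcast transition $p\xrightarrow{!a}p'$ and an arbitrary number $k\ge0$ of other processes taking receive transitions $p_1\xrightarrow{?a}p_1',\dots,p_k\xrightarrow{?a}p_k'$ with the same letter $a$. - Disjunctive guard. Transitions $p\xrightarrow{G_\exists}q$ with $p,q\in C$ or $p,q\in Q$ and $G_\exists\subseteq C\cup Q$. A configuration $(c,\mathbf{v})$ satisfies $G_\exists$ if $c\in G_\exists$ or $\mathbf{v}(r)\ge1$ for some $r\in G_\exists$. A step consists of one or more processes taking the same transition $p\xrightarrow{G_\exists}q$ from a configuration satisfying $G_\exists$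 such that the resulting configuration also satisfies $G_\exists$. - Synchronization. Transitions $p\xrightarrow{a}q$ with $a\in\Sigma$ ($\Sigma$ a finite set of labels) and $p,q\in C$ or $p,q\in Q$. In a step on $a$, all processes (controller and users) take a transition with label $a$ if such a transition is available from their current state (each choosing one if several are available), and otherwise stay in their current state. - ASM. Transitions $p\xrightarrow{l}q$ with $p,q\in Q$ and $l\in\{w(a),r(a)\mid a\in C\}$; in addition a controller transition $a\to b$ is available for all $a,b\in C$. A write step from $(c,\mathbf{v})$ consists of one or more user processes taking the same transition $p\xrightarrow{w(a)}q$ and the controller moving $c\to a$. A read step consists of one or more user processes taking the same transition $p\xrightarrow{r(a)}q$ and the controller taking $a\to a$ (so $c=a$ is required). *)

(* Defs.v *)
From HB Require Import structures.
From mathcomp Require Import all_boot.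

Set Implicit Arguments.
Unset Strict Implicit.
Unset Printing Implicit Defensive.

Definition config (C Q : finType) : Type := (C * {ffun Q -> nat})%type.

Record counter_system (C Q : finType) := CounterSystem {
  step : config C Q -> config C Q -> Prop;
  step_size : forall x y : config C Q,
    step x y -> \sum_(q : Q) x.2 q = \sum_(q : Q) y.2 q
}.

Definition le0 (C Q : finType) (x y : config C Q) : Prop :=
  x.1 = y.1 /\
  forall q : Q, x.2 q <= y.2 q /\ (x.2 q = 0 <-> y.2 q = 0).

Definition forward_compatible (C Q : finType)
    (le : config C Q -> config C Q -> Prop) (S : counter_system C Q) : Prop :=
  forall x x' y : config C Q, step S x x' -> le x y ->
    exists2 y' : config C Q, step S y y' & le x' y'.

Definition backward_compatible (C Q : finType)
    (le : config C Q -> config C Q -> Prop) (S : counter_system C Q) : Prop :=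
  forall x x' y' : config C Q, step S x x' -> le x' y' ->
    exists2 y : config C Q, step S y y' & le x y.

Definition fully_compatible (C Q : finType)
    (le : config C Q -> config C Q -> Prop) (S : counter_system C Q) : Prop :=
  forward_compatible le S /\ backward_compatible le S.

Definition trans (X L : Type) : Type := (X * L * X)%type.
Definition src (X L : Type) (t : trans X L) : X := t.1.1.
Definition lab (X L : Type) (t : trans X L) : L := t.1.2.
Definition dst (X L : Type) (t : trans X L) : X := t.2.

(* [inl] is a transition of the controller, [inr] one of the users. *)
Definition ltrans (C Q L : Type) : Type := (trans C L + trans Q L)%type.
Definition llab (C Q L : Type) (t : ltrans C Q L) : L :=
  match t with inl u => lab u | inr u => lab u end.

(* [m t] is the number of user processes that take the transition [t].  Each
   process takes at most one transition, so the departures from [q] are bounded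
   by the number of processes in [q]; this also makes the truncated subtraction
   below exact. *)
Definition departures (Q L : finType) (m : {ffun trans Q L -> nat}) (q : Q) :
  nat := \sum_(t : trans Q L | src t == q) m t.
Definition arrivals (Q L : finType) (m : {ffun trans Q L -> nat}) (q : Q) :
  nat := \sum_(t : trans Q L | dst t == q) m t.
Definition users_move (Q L : finType) (m : {ffun trans Q L -> nat})
    (v v' : {ffun Q -> nat}) : Prop :=
  forall q : Q, departures m q <= v q /\
    v' q = v q - departures m q + arrivals m q.

Definition controller_moves (C L : Type) (o : option (trans C L)) (c c' : C) :
    Prop :=
  match o with Some t => c = src t /\ c' = dst t | None => c' = c end.

Definition moves (C Q L : finType) (o : option (trans C L))
    (m : {ffun trans Q L -> nat}) (x y : config C Q) : Prop :=
  controller_moves o x.1 y.1 /\ users_move m x.2 y.2.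

(* The number of processes that take [t]. *)
Definition taken (C Q L : finType) (o : option (trans C L))
    (m : {ffun trans Q L -> nat}) (t : ltrans C Q L) : nat :=
  match t with inl u => (o == Some u) : nat | inr u => m u end.

Definition induced_by (C Q : finType) (S : counter_system C Q)
    (R : config C Q -> config C Q -> Prop) : Prop :=
  forall x y : config C Q, step S x y <-> R x y.

Inductive bcast_label (A : Type) : Type := Send of A | Receive of A.

Definition sum_of_bcast (A : Type) (l : bcast_label A) : A + A :=
  match l with Send a => inl a | Receive a => inr a end.
Definition bcast_of_sum (A : Type) (s : A + A) : bcast_label A :=
  match s with inl a => Send a | inr a => Receive a end.
Lemma sum_of_bcastK (A : Type) :
  cancel (@sum_of_bcast A) (@bcast_of_sum A).
Proof. by case. Qed.
HB.instance Definition _ (A : finType) :=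
  Finite.copy (bcast_label A) (can_type (@sum_of_bcastK A)).

Definition broadcast_step (C Q A : finType)
    (T : {set ltrans C Q (bcast_label A)}) (x y : config C Q) : Prop :=
  exists (a : A) (t : ltrans C Q (bcast_label A))
      (o : option (trans C (bcast_label A)))
      (m : {ffun trans Q (bcast_label A) -> nat}),
    [/\ moves o m x y, t \in T /\ llab t = Send a, 0 < taken o m t &
      forall u : ltrans C Q (bcast_label A), 0 < taken o m u -> u != t ->
        u \in T /\ llab u = Receive a].

Definition broadcast_induced (C Q : finType) (S : counter_system C Q) : Prop :=
  exists (A : finType) (T : {set ltrans C Q (bcast_label A)}),
    induced_by S (broadcast_step T).

(* The union of [C] and [Q] is read as a disjoint union. *)
Definition guard (C Q : finType) : Type := {set C + Q}.

Definition satisfies (C Q : finType) (x : config C Q) (G : guard C Q) : Prop :=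
  inl x.1 \in G \/ exists2 r : Q, inr r \in G & 1 <= x.2 r.

Definition disjunctive_step (C Q : finType)
    (T : {set ltrans C Q (guard C Q)}) (x y : config C Q) : Prop :=
  exists (t : ltrans C Q (guard C Q)) (o : option (trans C (guard C Q)))
      (m : {ffun trans Q (guard C Q) -> nat}),
    [/\ t \in T, moves o m x y,
      0 < taken o m t /\
        (forall u : ltrans C Q (guard C Q), 0 < taken o m u -> u = t),
      satisfies x (llab t) & satisfies y (llab t)].

Definition disjunctive_induced (C Q : finType) (S : counter_system C Q) :
    Prop :=
  exists T : {set ltrans C Q (guard C Q)}, induced_by S (disjunctive_step T).

(* A process with no available transition on [a] stays in its state, because
   only transitions of [T] labelled [a] are taken. *)
Definition synchronization_step (C Q A : finType) (T : {set ltrans C Q A})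
    (x y : config C Q) : Prop :=
  exists (a : A) (o : option (trans C A)) (m : {ffun trans Q A -> nat}),
    [/\ moves o m x y,
      forall t : ltrans C Q A, 0 < taken o m t -> t \in T /\ llab t = a,
      (exists c : C, inl (x.1, a, c) \in T) -> o <> None &
      forall p : Q, (exists q : Q, inr (p, a, q) \in T) ->
        departures m p = x.2 p].

Definition synchronization_induced (C Q : finType) (S : counter_system C Q) :
    Prop :=
  exists (A : finType) (T : {set ltrans C Q A}),
    induced_by S (synchronization_step T).

Inductive asm_label (A : Type) : Type := Write of A | Read of A.

Definition sum_of_asm (A : Type) (l : asm_label A) : A + A :=
  match l with Write a => inl a | Read a => inr a end.
Definition asm_of_sum (A : Type) (s : A + A) : asm_label A :=
  match s with inl a => Write a | inr a => Read a end.
Lemma sum_of_asmK (A : Type) : cancel (@sum_of_asm A) (@asm_of_sum A).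
Proof. by case. Qed.
HB.instance Definition _ (A : finType) :=
  Finite.copy (asm_label A) (can_type (@sum_of_asmK A)).

(* The controller transitions [a -> b] exist for all [a] and [b], so they are
   not listed in [T]. *)
Definition asm_step (C Q : finType) (T : {set trans Q (asm_label C)})
    (x y : config C Q) : Prop :=
  exists (t : trans Q (asm_label C)) (m : {ffun trans Q (asm_label C) -> nat}),
    [/\ t \in T, users_move m x.2 y.2,
      0 < m t /\ (forall u : trans Q (asm_label C), 0 < m u -> u = t) &
      match lab t with
      | Write a => y.1 = a
      | Read a => x.1 = a /\ y.1 = a
      end].

Definition asm_induced (C Q : finType) (S : counter_system C Q) : Prop :=
  exists T : {set trans Q (asm_label C)}, induced_by S (asm_step T).

(* Main.v *)
Require Import Defs.
From mathcomp Require Import all_boot.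
From mathcomp Require Import zify.

Set Implicit Arguments.
Unset Strict Implicit.
Unset Printing Implicit Defensive.

(** Both kinds of compatibility amount to adding processes to a step.  If extra
    processes are added to states that are occupied before the step, each can
    copy a process of the same state, taking the same transition or staying put
    as it does; then every transition count and every count of idle processes
    grows without leaving or entering zero, and so do their sums, the occupations
    after the step.  Adding processes after the step is symmetric, with the two
    ends of the transitions exchanged.  Each type of step only depends on which
    counts are zero, on the controller, and on which states are occupied. *)

Definition same_support_le (I : Type) (f g : I -> nat) : Prop :=
  forall i, f i <= g i /\ (f i = 0 <-> g i = 0).

Lemma same_support_le_gt0 (I : Type) (f g : I -> nat) (i : I) :
  same_support_le f g -> (0 < g i) = (0 < f i).
Proof. by move=> /(_ i) fg; lia. Qed.

Lemma same_support_le_sum (I : finType) (P : pred I) (f g : I -> nat) :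
  same_support_le f g ->
  \sum_(i | P i) f i <= \sum_(i | P i) g i /\
  (\sum_(i | P i) f i = 0 <-> \sum_(i | P i) g i = 0).
Proof.
move=> fg; split; first by apply: leq_sum => i _; case: (fg i).
split=> /eqP; rewrite sum_nat_eq0 => /forall_inP h0; apply/eqP;
  rewrite sum_nat_eq0; apply/forall_inP => i /h0 /eqP hi; apply/eqP.
  by apply/(fg i).2.
by apply/(fg i).2.
Qed.

(** In each fiber of [a] the whole surplus goes to a single index at which [f] is positive. Such an
    index exists unless [f] sums to zero on the fiber, and then [w q] is zero too. *)
Lemma fiber_sum_extend (I Q : finType) (a : I -> Q) (f : I -> nat)
    (w : Q -> nat) :
  same_support_le (fun q => \sum_(i | a i == q) f i) w ->
  exists2 g : I -> nat, same_support_le f g &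
    forall q, w q = \sum_(i | a i == q) g i.
Proof.
move=> fw.
pose v q := \sum_(i | a i == q) f i.
pose r q := [pick i | (a i == q) && (0 < f i)].
pose e i := if r (a i) == Some i then w (a i) - v (a i) else 0.
exists (fun i => f i + e i) => [i|q].
  have : f i = 0 -> e i = 0.
    rewrite /e /r => fi0; case: pickP => [j /andP[_ fj]|//].
    by case: eqP => // -[ji]; move: fj; rewrite ji fi0.
  by lia.
rewrite big_split /= -/(v q).
have := fw q; rewrite -/(v q) => -[vw vw0].
case rq: (r q) => [j|].
  have /eqP aj : a j == q.
    by move: rq; rewrite /r; case: pickP => // k /andP[ak _] [<-].
  rewrite (bigD1 j) ?aj //= big1 => [|i /andP[/eqP ai ij]].
    by rewrite /e aj rq eqxx; lia.
  by rewrite /e ai rq; case: eqP => // -[ji]; rewrite ji eqxx in ij.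
have v0 : v q = 0.
  apply/eqP; rewrite sum_nat_eq0; apply/forall_inP => i ai.
  by move: rq; rewrite /r; case: pickP => // /(_ i); rewrite ai /=; lia.
rewrite big1 => [|i /eqP ai]; first by lia.
by rewrite /e ai rq.
Qed.

(* [s] counts the idle processes, [e] is either end of the transitions. *)
Lemma flow_extend (T Q : finType) (e : T -> Q) (m : T -> nat)
    (s v w : Q -> nat) :
  (forall q, v q = s q + \sum_(t | e t == q) m t) -> same_support_le v w ->
  exists (m' : {ffun T -> nat}) (s' : Q -> nat),
    [/\ same_support_le m m', same_support_le s s' &
      forall q, w q = s' q + \sum_(t | e t == q) m' t].
Proof.
move=> vE vw.
(* Staying put is treated as one more transition: [inr q] joins the fiber over [q], with count
   [s q]. *)
pose a (i : T + Q) := match i with inl t => e t | inr q => q end.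
have sumE (h : T + Q -> nat) q :
    \sum_(i | a i == q) h i = h (inr q) + \sum_(t | e t == q) h (inl t).
  by rewrite big_sumType /= big_pred1_eq addnC.
pose f (i : T + Q) := match i with inl t => m t | inr q => s q end.
have [g fg wE] : exists2 g, same_support_le f g &
    forall q, w q = \sum_(i | a i == q) g i.
  by apply: fiber_sum_extend => q; rewrite sumE /= -vE.
exists [ffun t => g (inl t)], (fun q => g (inr q)).
split=> [t|q|q]; first by rewrite ffunE; apply: (fg (inl t)).
  exact: (fg (inr q)).
rewrite wE sumE; congr (_ + _); apply: eq_bigr => t _.
by rewrite ffunE.
Qed.

Section UsersMove.

Variables (Q L : finType).
Implicit Types (m : {ffun trans Q L -> nat}) (v w : {ffun Q -> nat}).

(** Counting idle processes replaces the truncated subtraction by two sums of the same shape, so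
    that both ends of a move can be treated alike. *)
Lemma users_move_idle m v v' : users_move m v v' ->
  exists s : Q -> nat, forall q,
    v q = s q + departures m q /\ v' q = s q + arrivals m q.
Proof.
by move=> mv; exists (fun q => v q - departures m q) => q; have := mv q; lia.
Qed.

Lemma idle_users_move m v v' (s : Q -> nat) :
  (forall q, v q = s q + departures m q) ->
  (forall q, v' q = s q + arrivals m q) -> users_move m v v'.
Proof. by move=> vE v'E q; have := vE q; have := v'E q; lia. Qed.

(** The clause on departures serves synchronization steps: where every process takes a transition,
    no idle one may be added. *)
Definition move_extension m v w m' v' w' : Prop :=
  [/\ users_move m' v' w', same_support_le v v', same_support_le w w',
      same_support_le m m' &
      forall q, departures m q = v q -> departures m' q = v' q].

Lemma idle_extension m v w m' v' w' (s s' : Q -> nat) :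
  (forall q, v q = s q + departures m q) ->
  (forall q, w q = s q + arrivals m q) ->
  (forall q, v' q = s' q + departures m' q) ->
  (forall q, w' q = s' q + arrivals m' q) ->
  same_support_le m m' -> same_support_le s s' ->
  move_extension m v w m' v' w'.
Proof.
move=> vE wE v'E w'E mm' ss'; split=> [||||q] //.
- exact: idle_users_move v'E w'E.
- move=> q; rewrite vE v'E; have := ss' q.
  by have := same_support_le_sum (fun t => src t == q) mm';
    rewrite -/(departures m q) -/(departures m' q); lia.
- move=> q; rewrite wE w'E; have := ss' q.
  by have := same_support_le_sum (fun t => dst t == q) mm';
    rewrite -/(arrivals m q) -/(arrivals m' q); lia.
(* If all processes in [q] depart, then [s q = 0], hence [s' q = 0]. *)
by rewrite vE v'E; have := ss' q; lia.
Qed.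

Lemma users_move_extend_src m v w v' :
  users_move m v w -> same_support_le v v' ->
  exists m' w', move_extension m v w m' v' w'.
Proof.
move=> /users_move_idle[s mE] vv'.
have [m' [s' [mm' ss' v'E]]] := flow_extend (fun q => (mE q).1) vv'.
(* Only the source is prescribed; the target is read off from the extended counts. *)
exists m', [ffun q => s' q + arrivals m' q].
apply: (@idle_extension _ _ _ _ _ _ s s') => // q; try by case: (mE q).
by rewrite ffunE.
Qed.

Lemma users_move_extend_dst m v w w' :
  users_move m v w -> same_support_le w w' ->
  exists m' v', move_extension m v w m' v' w'.
Proof.
move=> /users_move_idle[s mE] ww'.
have [m' [s' [mm' ss' w'E]]] := flow_extend (fun q => (mE q).2) ww'.
exists m', [ffun q => s' q + departures m' q].
apply: (@idle_extension _ _ _ _ _ _ s s') => // q; try by case: (mE q).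
by rewrite ffunE.
Qed.

End UsersMove.

(** Neither end of the larger step is prescribed, so this one property gives both directions of
    compatibility: forward by extending at the source, backward by extending at the target. *)
Definition extensible (C Q L : finType)
    (R : config C Q -> config C Q -> Prop) : Prop :=
  forall x x', R x x' -> exists2 m : {ffun trans Q L -> nat},
    users_move m x.2 x'.2 &
    forall y y' m', x.1 = y.1 -> x'.1 = y'.1 ->
      move_extension m x.2 x'.2 m' y.2 y'.2 -> R y y'.

Lemma extensible_compatible (C Q L : finType) (S : counter_system C Q)
    (R : config C Q -> config C Q -> Prop) :
  induced_by S R -> extensible L R -> fully_compatible (@le0 C Q) S.
Proof.
move=> SR extR; split=> x x' y /SR /extR[m mx ext] [c_eq vw].
  have [m' [w' mm']] := users_move_extend_src mx vw.
  exists (x'.1, w'); first by apply/SR; exact: (ext y (x'.1, w') m').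
  by split=> //; case: mm'.
have [m' [w' mm']] := users_move_extend_dst mx vw.
exists (x.1, w'); first by apply/SR; exact: (ext (x.1, w') y m').
by split=> //; case: mm'.
Qed.

(** The controller's choice [o] is kept, and user counts matter only through their support. *)
Lemma taken_gt0 (C Q L : finType) (o : option (trans C L))
    (m m' : {ffun trans Q L -> nat}) (t : ltrans C Q L) :
  same_support_le m m' -> (0 < taken o m' t) = (0 < taken o m t).
Proof. by case: t => //= u mm'; apply: same_support_le_gt0 mm'. Qed.

(** Guards are existential, so additional processes cannot falsify them. Disjunctive steps need this
    at both ends. *)
Lemma satisfies_le0 (C Q : finType) (x y : config C Q) (G : guard C Q) :
  le0 x y -> satisfies x G -> satisfies y G.
Proof.
move=> [c_eq xy] [cG|[r rG xr]]; first by left; rewrite -c_eq.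
by right; exists r => //; have := xy r; lia.
Qed.

Lemma broadcast_extensible (C Q A : finType)
    (T : {set ltrans C Q (bcast_label A)}) :
  extensible (bcast_label A) (broadcast_step T).
Proof.
move=> x x' [a [t [o [m [[co mx] tT t0 others]]]]].
exists m => // y y' m' xy xy' [my _ _ mm' _].
exists a, t, o, m'; split=> // [||u].
- by split=> //; rewrite -xy -xy'.
- by rewrite (taken_gt0 _ _ mm').
by rewrite (taken_gt0 _ _ mm'); apply: others.
Qed.

Lemma disjunctive_extensible (C Q : finType)
    (T : {set ltrans C Q (guard C Q)}) :
  extensible (guard C Q) (disjunctive_step T).
Proof.
move=> x x' [t [o [m [tT [co mx] [t0 only] xG x'G]]]].
exists m => // y y' m' xy xy' [my vv ww mm' _].
exists t, o, m'; split=> //.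
- by split=> //; rewrite -xy -xy'.
- split=> [|u]; rewrite (taken_gt0 _ _ mm') //; exact: only.
- exact: (@satisfies_le0 _ _ x).
exact: (@satisfies_le0 _ _ x').
Qed.

Lemma synchronization_extensible (C Q A : finType)
    (T : {set ltrans C Q A}) :
  extensible A (synchronization_step T).
Proof.
move=> x x' [a [o [m [[co mx] inT ctrl users]]]].
exists m => // y y' m' xy xy' [my _ _ mm' dep].
exists a, o, m'; split=> // [|u||p pT].
- by split=> //; rewrite -xy -xy'.
- by rewrite (taken_gt0 _ _ mm'); apply: inT.
- by rewrite -xy.
(* In the given step no process in [p] is idle, and this survives the extension. *)
by apply: dep; apply: users.
Qed.

Lemma asm_extensible (C Q : finType) (T : {set trans Q (asm_label C)}) :
  extensible (asm_label C) (asm_step T).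
Proof.
move=> x x' [t [m [tT mx [t0 only] ctrl]]].
exists m => // y y' m' xy xy' [my _ _ mm' _].
exists t, m'; split=> //; last by rewrite -xy -xy'.
by split=> [|u]; rewrite (same_support_le_gt0 _ mm') //; apply: only.
Qed.

Theorem lemma3 (C Q : finType) (S : counter_system C Q)
    (hS : broadcast_induced S \/ disjunctive_induced S \/
          synchronization_induced S \/ asm_induced S) :
  fully_compatible (@le0 C Q) S.
Proof.
case: hS => [[A [T SR]]|[[T SR]|[[A [T SR]]|[T SR]]]].
- exact: (extensible_compatible SR (@broadcast_extensible _ _ _ T)).
- exact: (extensible_compatible SR (@disjunctive_extensible _ _ T)).
- exact: (extensible_compatible SR (@synchronization_extensible _ _ _ T)).
exact: (extensible_compatible SR (@asm_extensible _ _ T)).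
Qed.
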